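(* Let $\mathcal{X}=\{\boldsymbol{x}\in\mathbb{R}^n:\|\boldsymbol{x}\|_2\le1\}$, let $\kappa=\max_{\boldsymbol{x}\in\mathcal{X}}\|\boldsymbol{x}\|_2$ and $\mathcal{C}=\mathrm{cone}(\{\kappa\}\times\mathcal{X})\subset\mathbb{R}^{n+1}$. Then for every $\boldsymbol{u}\in\mathbb{R}^{n+1}$ the orthogonal projection $\pi_{\mathcal{C}}(\boldsymbol{u})$ can be computed in $O(n)$ operations.
   Context: $\mathrm{cone}(\{\kappa\}\times\mathcal{X})=\{\alpha(\kappa,\boldsymbol{x}):\alpha\ge0,\boldsymbol{x}\in\mathcal{X}\}$; $\pi_{\mathcal{C}}$ denotes the Euclidean orthogonal projection onto $\mathcal{C}$. Operations are counted over the reals: each addition, subtraction, multiplication, division, comparison and root extraction counts as one operation. *)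

(* Defs.v *)
From HB Require Import structures.
From mathcomp Require Import all_boot all_order all_algebra.
From mathcomp Require Import all_classical all_reals all_analysis.

Set Implicit Arguments.
Unset Strict Implicit.
Unset Printing Implicit Defensive.

Import Order.TTheory GRing.Theory Num.Theory.
Import numFieldNormedType.Exports.

Local Open Scope classical_set_scope.
Local Open Scope ring_scope.

(* The canonical norm of ['rV[R]_m] in MathComp-Analysis is the sup norm, so
   the Euclidean norm is defined separately. *)
Definition norm2 (R : realType) (m : nat) (x : 'rV[R]_m) : R :=
  Num.sqrt (\sum_(i < m) x 0 i ^+ 2).

Definition unit_ball (R : realType) (n : nat) : set 'rV[R]_n :=
  [set x | norm2 x <= 1].

Definition is_max (R : realType) (A : set R) (m : R) : Prop :=
  A m /\ ubound A m.

(* A pair (k, x) of R x R^n is the row vector [row_mx k%:M x] of R^(1+n). *)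
Definition cone_over (R : realType) (n : nat) (k : R) (X : set 'rV[R]_n) :
    set 'rV[R]_(1 + n) :=
  [set v | exists a x, [/\ 0 <= a, X x & v = a *: row_mx k%:M x]].

Definition nearest (R : realType) (m : nat) (C : set 'rV[R]_m) (u : 'rV[R]_m) :
    set 'rV[R]_m :=
  [set v | C v /\ forall w, C w -> norm2 (u - v) <= norm2 (u - w)].

(* [v] is the projection of [u]: the unique point of [C] nearest to [u]. *)
Definition is_proj (R : realType) (m : nat) (C : set 'rV[R]_m)
    (u v : 'rV[R]_m) : Prop :=
  nearest C u = [set v].

(* A real random access machine, programmed in a While language.  The store
   has natural-number registers, used only for indexing and loop control, and
   a real memory addressed by natural numbers.  Real numbers influence the
   rest of the computation only through the counted operations below. *)

Inductive iexp :=
| ICst of nat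
| IReg of nat
| IAdd of iexp & iexp
| ISub of iexp & iexp.

Inductive aop := Add | Sub | Mul | Div.

Inductive cmp := Le | Lt | Eq.

Inductive guard :=
| GIdx of iexp & iexp
| GReal of cmp & iexp & iexp.

(* In [CCst], [CCopy], [CArith] and [CRoot] the [iexp] arguments are memory
   addresses, the first one being the destination. *)
Inductive cmd :=
| CSkip
| CIdx of nat & iexp
| CCst of iexp & rat
| CCopy of iexp & iexp
| CArith of aop & iexp & iexp & iexp
| CRoot of nat & iexp & iexp
| CSeq of cmd & cmd
| CIf of guard & cmd & cmd
| CWhile of guard & cmd.

Record store (R : realType) := Store { regs : nat -> nat; mem : nat -> R }.

Fixpoint ieval (r : nat -> nat) (e : iexp) : nat :=
  match e with
  | ICst k => k
  | IReg i => r i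
  | IAdd e1 e2 => ieval r e1 + ieval r e2
  | ISub e1 e2 => ieval r e1 - ieval r e2
  end.

Definition cell (R : realType) (s : store R) (e : iexp) : R :=
  mem s (ieval (regs s) e).

Definition set_reg (R : realType) (s : store R) (i k : nat) : store R :=
  Store [eta regs s with i |-> k] (mem s).

Definition set_cell (R : realType) (s : store R) (e : iexp) (x : R) : store R :=
  Store (regs s) [eta mem s with ieval (regs s) e |-> x].

Definition aop_defined (R : realType) (o : aop) (y : R) : bool :=
  if o is Div then y != 0 else true.

Definition aop_eval (R : realType) (o : aop) (x y : R) : R :=
  match o with
  | Add => x + y
  | Sub => x - y
  | Mul => x * y
  | Div => x / y
  end.

Definition cmp_eval (R : realType) (c : cmp) (x y : R) : bool :=
  match c with
  | Le => x <= y
  | Lt => x < y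
  | Eq => x == y
  end.

Definition guard_eval (R : realType) (s : store R) (g : guard) : bool :=
  match g with
  | GIdx e1 e2 => (ieval (regs s) e1 < ieval (regs s) e2)%N
  | GReal c e1 e2 => cmp_eval c (cell s e1) (cell s e2)
  end.

Definition guard_cost (g : guard) : nat := if g is GReal _ _ _ then 1 else 0.

(* [run c s s' t]: started in [s], the command [c] halts in [s'] after exactly
   [t] operations over the reals.  Division by zero and even roots of negative
   numbers have no rule, so a program performing them does not halt.  For
   simplicity roots of odd order are also taken of nonnegative numbers only. *)
Inductive run (R : realType) : cmd -> store R -> store R -> nat -> Prop :=
| run_skip s : run CSkip s s 0
| run_idx s i e : run (CIdx i e) s (set_reg s i (ieval (regs s) e)) 0
| run_cst s a q : run (CCst a q) s (set_cell s a (ratr q)) 0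
| run_copy s a b : run (CCopy a b) s (set_cell s a (cell s b)) 0
| run_arith s o a b c : aop_defined o (cell s c) ->
    run (CArith o a b c) s (set_cell s a (aop_eval o (cell s b) (cell s c))) 1
| run_root s k a b y : (0 < k)%N -> 0 <= y -> y ^+ k = cell s b ->
    run (CRoot k a b) s (set_cell s a y) 1
| run_seq c1 c2 s1 s2 s3 t1 t2 :
    run c1 s1 s2 t1 -> run c2 s2 s3 t2 -> run (CSeq c1 c2) s1 s3 (t1 + t2)
| run_if g c1 c2 s s' t :
    run (if guard_eval s g then c1 else c2) s s' t ->
    run (CIf g c1 c2) s s' (guard_cost g + t)
| run_while_stop g c s : ~~ guard_eval s g ->
    run (CWhile g c) s s (guard_cost g)
| run_while_step g c s1 s2 s3 t1 t2 : guard_eval s1 g ->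
    run c s1 s2 t1 -> run (CWhile g c) s2 s3 t2 ->
    run (CWhile g c) s1 s3 (guard_cost g + t1 + t2).

(* The dimension [n] is in register 0 and the input vector in the cells
   0, ..., n of the memory; everything else is 0. *)
Definition init_store (R : realType) (n : nat) (u : 'rV[R]_(1 + n)) : store R :=
  Store (fun i => if i == 0%N then n else 0%N)
        (fun j => if insub j is Some i then u 0 i else 0).

Definition output (R : realType) (n : nat) (s : store R) : 'rV[R]_(1 + n) :=
  \row_i mem s i.

(* The same program [p] must work for every dimension [n]. *)
Definition computes_in (R : realType) (p : cmd) (T : nat -> nat)
    (spec : forall n, 'rV[R]_(1 + n) -> 'rV[R]_(1 + n) -> Prop) : Prop :=
  forall n (u : 'rV[R]_(1 + n)), exists s t,
    [/\ run p (init_store u) s t, (t <= T n)%N & spec n u (output n s)].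

(* Main.v *)
(** For [n >= 1] one has [kappa = 1] and the cone is the second-order cone
    [|x| <= t].  With [r = |x|], the projection of [(t, x)] is [(t, x)] if
    [r <= t], [0] if [t <= - r], and [((t + r) / 2) (1, x / r)] otherwise, which
    is checked with Moreau's conditions [v \in C], [u - v _|_ v] and
    [<u - v, w> <= 0] on [C].  So one pass over [x] for [r], a constant number
    of operations, and one pass for the rescaling are enough.  For [n = 0] one
    has [kappa = 0] and the cone is [{0}]. *)

Require Import Defs.
From mathcomp Require Import all_boot all_order all_algebra.
From mathcomp Require Import all_classical all_reals all_analysis.
From mathcomp Require Import ring lra zify.
Import Order.TTheory GRing.Theory Num.Theory.
Import numFieldNormedType.Exports.
Local Open Scope classical_set_scope.
Local Open Scope ring_scope.

Set Implicit Arguments.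
Unset Strict Implicit.
Unset Printing Implicit Defensive.

Lemma affine_bigO (R : realType) (a b : nat) :
  (fun n : nat => (a * n + b)%:R : R^o) =O_\oo (fun n : nat => n%:R : R^o).
Proof.
(* The successor keeps the constant positive even if [a = b = 0]; the term [b] is absorbed into
   [b * n] once [n > 0]. *)
apply/eqO_exP; exists (a + b).+1%:R; first by rewrite ltr0n.
near=> n.
rewrite !normr_nat -natrM ler_nat.
have n0 : (0 < n)%N by near: n; exact: nbhs_infty_gt.
by rewrite mulSn mulnDl addnCA leq_add2l (leq_trans _ (leq_addl _ _))// leq_pmulr.
Unshelve. all: by end_near. Qed.

(** * Euclidean geometry and projection onto the second-order cone *)

Section Euclidean.
Variables (R : realType).

Definition dot m (x y : 'rV[R]_m) : R := \sum_(i < m) x 0 i * y 0 i.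

Lemma sqr_norm2 m (x : 'rV[R]_m) : norm2 x ^+ 2 = dot x x.
Proof. by rewrite sqr_sqrtr// sumr_ge0// => i _; rewrite sqr_ge0. Qed.

Lemma norm2_ge0 m (x : 'rV[R]_m) : 0 <= norm2 x.
Proof. exact: sqrtr_ge0. Qed.

Lemma norm2_eq0 m (x : 'rV[R]_m) : norm2 x = 0 -> x = 0.
Proof.
move=> x0; apply/rowP => i; rewrite mxE; apply/eqP; rewrite -sqrf_eq0.
have : dot x x == 0 by rewrite -sqr_norm2 x0 expr0n.
rewrite psumr_eq0 => [/allP/(_ i)|j _]; last by rewrite -expr2 sqr_ge0.
by rewrite mem_index_enum; apply.
Qed.

Lemma norm2Z m (a : R) (x : 'rV[R]_m) : 0 <= a -> norm2 (a *: x) = a * norm2 x.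
Proof.
move=> a0; apply/eqP; rewrite -(@eqrXn2 _ 2)// ?mulr_ge0 ?norm2_ge0//.
rewrite exprMn !sqr_norm2 mulr_sumr; apply/eqP/eq_bigr => i _.
by rewrite !mxE; ring.
Qed.

Lemma norm20 m : norm2 (0 : 'rV[R]_m) = 0.
Proof. by rewrite -(scale0r 0) norm2Z ?mul0r. Qed.

Lemma dotZl m (a : R) (x y : 'rV[R]_m) : dot (a *: x) y = a * dot x y.
Proof. by rewrite mulr_sumr; apply: eq_bigr => i _; rewrite mxE mulrA. Qed.

Lemma dotZr m (a : R) (x y : 'rV[R]_m) : dot x (a *: y) = a * dot x y.
Proof. by rewrite mulr_sumr; apply: eq_bigr => i _; rewrite mxE mulrCA. Qed.

Lemma dot_row_mx n (s t : R) (x y : 'rV[R]_n) :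
  dot (row_mx s%:M x) (row_mx t%:M y) = s * t + dot x y.
Proof.
rewrite /dot big_split_ord big_ord1/= !row_mxEl !mxE eqxx !mulr1n.
by congr (_ + _); apply: eq_bigr => i _; rewrite !row_mxEr.
Qed.

Lemma sqr_norm2B m (x y : 'rV[R]_m) :
  norm2 (x - y) ^+ 2 = norm2 x ^+ 2 + norm2 y ^+ 2 - 2 * dot x y.
Proof.
rewrite !sqr_norm2 mulr_sumr -big_split -sumrB; apply: eq_bigr => i _.
by rewrite !mxE /=; ring.
Qed.

(** Expand the square of the norm of [norm2 y *: x - norm2 x *: y], which is nonnegative, and cancel
    the factor [norm2 x * norm2 y]; zero vectors are treated first to make this factor positive. *)
Lemma cauchy_schwarz m (x y : 'rV[R]_m) : dot x y <= norm2 x * norm2 y.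
Proof.
have [/norm2_eq0->|x0] := eqVneq (norm2 x) 0.
  by rewrite norm20 mul0r -(scale0r 0) dotZl mul0r.
have [/norm2_eq0->|y0] := eqVneq (norm2 y) 0.
  by rewrite norm20 mulr0 -(scale0r 0) dotZr mul0r.
have xy0 : 0 < norm2 x * norm2 y.
  by rewrite mulr_gt0// lt_neqAle norm2_ge0 eq_sym ?x0 ?y0.
have := sqr_norm2B (norm2 y *: x) (norm2 x *: y).
rewrite !norm2Z ?norm2_ge0// dotZl dotZr => e.
have := sqr_ge0 (norm2 (norm2 y *: x - norm2 x *: y)).
by rewrite e -[in dot x y <= _](ler_pM2l xy0); nra.
Qed.

(* Moreau's optimality conditions. *)
Lemma is_proj_cone m (C : set 'rV[R]_m) (u v : 'rV[R]_m) :
  C v -> dot (u - v) v = 0 -> (forall w, C w -> dot (u - v) w <= 0) ->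
  is_proj C u v.
Proof.
move=> Cv uv0 uvC.
(* The angle at [v] is not acute. Dropping [norm2 (v - w) ^+ 2] gives minimality of [v]; keeping it
   forces any other minimizer to equal [v]. *)
have pyth w : C w -> norm2 (u - v) ^+ 2 + norm2 (v - w) ^+ 2 <= norm2 (u - w) ^+ 2.
  move=> Cw.
  have -> : norm2 (u - w) ^+ 2 = norm2 (u - v) ^+ 2 + norm2 (v - w) ^+ 2
      + 2 * dot (u - v) v - 2 * dot (u - v) w.
    rewrite !sqr_norm2 !mulr_sumr -!big_split -sumrB; apply: eq_bigr => i _.
    by rewrite !mxE/=; ring.
  by have := uvC _ Cw; rewrite uv0; lra.
rewrite /is_proj; apply/seteqP; split => [w [Cw wmin]|_ ->]; last first.
  split=> // w Cw; rewrite -(@ler_pXn2r _ 2) ?nnegrE ?norm2_ge0//.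
  by apply: le_trans (pyth _ Cw); rewrite lerDl sqr_ge0.
have := wmin v Cv; rewrite -(@ler_pXn2r _ 2) ?nnegrE ?norm2_ge0// => uw.
have vw : norm2 (v - w) ^+ 2 <= 0 by have := pyth _ Cw; lra.
have /eqP : norm2 (v - w) ^+ 2 = 0 by apply/eqP; rewrite eq_le vw sqr_ge0.
by rewrite sqrf_eq0 => /eqP/norm2_eq0/eqP; rewrite subr_eq0 => /eqP ->.
Qed.

Lemma cone_over1P n (a : R) (y : 'rV[R]_n) :
  cone_over 1 (@unit_ball R n) (row_mx a%:M y) <-> norm2 y <= a.
Proof.
split=> [[b [x [b0 x1]]]|ya].
  rewrite scale_row_mx scale_scalar_mx mulr1.
  move=> /eq_row_mx[ab ->]; have := congr1 (fun A : 'M[R]_1 => A 0 0) ab.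
  rewrite !mxE eqxx !mulr1n => ->.
  by rewrite norm2Z// ler_piMr.
have a0 : 0 <= a by exact: le_trans (norm2_ge0 y) ya.
(* At the apex [a = 0] the vector [y] vanishes and any point of the ball serves; otherwise the ball
   point is [y] rescaled by [a^-1]. *)
exists a; have [a_0|an0] := eqVneq a 0.
  exists 0; split => //; first by rewrite /unit_ball/= norm20.
  have /norm2_eq0-> : norm2 y = 0.
    by apply/eqP; rewrite eq_le norm2_ge0 -a_0 ya.
  by rewrite a_0 scale0r raddf0 row_mx0.
have a_gt0 : 0 < a by rewrite lt_neqAle eq_sym an0.
exists (a^-1 *: y); split => //.
  by rewrite /unit_ball/= norm2Z ?invr_ge0// mulrC ler_pdivrMr ?mul1r.
by rewrite scale_row_mx scale_scalar_mx mulr1 scalerA mulfV// scale1r.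
Qed.

(** For [n = 0] the only vector has norm 0; for [n > 0] a standard basis vector attains the bound
    1. *)
Lemma is_max_norm2_unit_ball n (k : R) :
  is_max (@norm2 R n @` @unit_ball R n) k -> k = (n != 0)%:R.
Proof.
case: n => [|n] [[x x1 xk] kub].
  by rewrite -xk /norm2 big_ord0 sqrtr0.
have e1 : norm2 (delta_mx 0 0 : 'rV[R]_n.+1) = 1.
  rewrite /norm2 (bigD1 ord0)//= big1 => [|i i0]; rewrite !mxE ?eqxx/=.
    by rewrite addr0 expr1n sqrtr1.
  by rewrite (negPf i0) expr0n.
apply/eqP; rewrite eq_le -{1}xk x1/=; apply: kub; exists (delta_mx 0 0).
  by rewrite /unit_ball/= e1.
exact: e1.
Qed.

(* Meant for [r = norm2 x], the projection of [(t, x)] being [(s, f x)]. *)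
Definition soc_factors (t r : R) : R * R :=
  if r <= t then (t, 1)
  else if t + r <= 0 then (0, 0)
  else ((t + r) / 2, (t + r) / 2 / r).

Lemma is_proj_soc n (t : R) (x : 'rV[R]_n) :
  is_proj (cone_over 1 (@unit_ball R n)) (row_mx t%:M x)
    (row_mx (soc_factors t (norm2 x)).1%:M ((soc_factors t (norm2 x)).2 *: x)).
Proof.
have r0 := norm2_ge0 x.
have uvE s f : row_mx t%:M x - row_mx s%:M (f *: x) =
    row_mx (t - s)%:M ((1 - f) *: x).
  by rewrite opp_row_mx add_row_mx raddfB scalerBl scale1r.
(* Moreau's conditions reduced to scalars: [a] is the first coordinate of a point of the cone and
   [b] the inner product of [x] with its tail, so Cauchy-Schwarz gives [b <= norm2 x * a]. *)
have proj s f : 0 <= f -> f * norm2 x <= s ->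
    (t - s) * s + (1 - f) * (f * norm2 x ^+ 2) = 0 ->
    (forall a b, 0 <= a -> b <= norm2 x * a -> (t - s) * a + (1 - f) * b <= 0) ->
    is_proj (cone_over 1 (@unit_ball R n)) (row_mx t%:M x) (row_mx s%:M (f *: x)).
  move=> f0 fs uv0 uvC; apply: is_proj_cone; rewrite ?uvE.
  - by apply/cone_over1P; rewrite norm2Z.
  - by rewrite dot_row_mx dotZl dotZr -sqr_norm2.
  move=> w; rewrite -(hsubmxK w) [lsubmx w]mx11_scalar => /cone_over1P wC.
  rewrite dot_row_mx dotZl; apply: uvC.
    exact: le_trans (norm2_ge0 _) wC.
  by apply: le_trans (cauchy_schwarz _ _) _; rewrite ler_wpM2l.
rewrite /soc_factors; case: ifPn => [rt|]; last rewrite -ltNge => tr.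
  by apply: proj => //=; [lra|ring|move=> a b _ _; lra].
case: ifPn => [tr0|]; last rewrite -ltNge => tr0.
  apply: proj => //=; [lra|lra|move=> a b a0 ba].
  suff : (t + norm2 x) * a <= 0 by lra.
  exact: mulr_le0_ge0.
have rn0 : norm2 x != 0 by rewrite gt_eqF//; lra.
have f0 : 0 <= (t + norm2 x) / 2 / norm2 x.
  by rewrite !divr_ge0//; lra.
apply: proj => //=.
- by rewrite divfK.
- by field.
move=> a b _ ba.
(* Both residual coefficients are multiples of [norm2 x - t], so the sign of the expression is that
   of [b - norm2 x * a]. *)
have -> : (t - (t + norm2 x) / 2) * a + (1 - (t + norm2 x) / 2 / norm2 x) * b =
  ((norm2 x - t) / 2 / norm2 x) * (b - norm2 x * a) by field.
by rewrite mulr_ge0_le0 ?subr_le0// !divr_ge0//; lra.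
Qed.

End Euclidean.

(** * Cost-bounded program logic for the machine *)

Section Programs.
Variables (R : realType).
Local Notation mem := Defs.mem.
Implicit Types (s : store R) (c : cmd) (Q : store R -> Prop).

(** A weakest precondition with a budget. An upper bound instead of the exact cost lets branches of
    different lengths share one budget. *)
Definition halts_in c s (b : nat) Q :=
  exists s' t, [/\ run c s s' t, (t <= b)%N & Q s'].

Lemma halts_in_idx i e s b Q :
  Q (set_reg s i (ieval (regs s) e)) -> halts_in (CIdx i e) s b Q.
Proof. by move=> Qs; eexists _, 0%N; split; [exact: run_idx| |]. Qed.

Lemma halts_in_cst a q s b Q :
  Q (set_cell s a (ratr q)) -> halts_in (CCst a q) s b Q.
Proof. by move=> Qs; eexists _, 0%N; split; [exact: run_cst| |]. Qed.

Lemma halts_in_arith o x y z s b Q : aop_defined o (cell s z) -> (0 < b)%N ->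
  Q (set_cell s x (aop_eval o (cell s y) (cell s z))) ->
  halts_in (CArith o x y z) s b Q.
Proof. by move=> oz b0 Qs; eexists _, 1%N; split; [exact: run_arith| |]. Qed.

Lemma halts_in_sqrt x y s b Q : 0 <= cell s y -> (0 < b)%N ->
  Q (set_cell s x (Num.sqrt (cell s y))) -> halts_in (CRoot 2 x y) s b Q.
Proof.
move=> y0 b0 Qs; eexists _, 1%N; split; [|by []|exact: Qs].
by apply: run_root; rewrite ?sqrtr_ge0 ?sqr_sqrtr.
Qed.

Lemma halts_in_seq c1 c2 s b1 b2 b Q : (b1 + b2 <= b)%N ->
  halts_in c1 s b1 (fun s' => halts_in c2 s' b2 Q) ->
  halts_in (CSeq c1 c2) s b Q.
Proof.
move=> b12 [s1 [t1 [r1 t1b [s2 [t2 [r2 t2b Qs]]]]]].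
exists s2, (t1 + t2)%N; split=> //; first exact: run_seq r1 r2.
by apply: leq_trans b12; exact: leq_add.
Qed.

Lemma halts_in_if g c1 c2 s b Q :
  halts_in (if guard_eval s g then c1 else c2) s b Q ->
  halts_in (CIf g c1 c2) s (guard_cost g + b) Q.
Proof.
move=> [s' [t [r tb Qs]]]; exists s', (guard_cost g + t)%N.
by split=> //; [exact: run_if|rewrite leq_add2l].
Qed.

Lemma halts_in_weaken c s b b' Q Q' : (b <= b')%N -> (forall s', Q s' -> Q' s') ->
  halts_in c s b Q -> halts_in c s b' Q'.
Proof.
move=> bb' QQ' [s' [t [r tb Qs]]].
by exists s', t; split; [|exact: leq_trans tb bb'|exact: QQ'].
Qed.

Definition for_cmd c :=
  CWhile (GIdx (IReg 1) (IReg 0)) (CSeq c (CIdx 1 (IAdd (IReg 1) (ICst 1)))).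

(** Counter tests and increments are free, so only the body is charged. The invariant fixes
    registers 0 and 1 so that it decides the loop guard. *)
Lemma halts_in_for c n b (I : nat -> store R -> Prop) s :
  (forall i s', I i s' -> regs s' 0%N = n /\ regs s' 1%N = i) ->
  (forall i s', (i < n)%N -> I i s' ->
     halts_in c s' b (fun s'' => I i.+1 (set_reg s'' 1 (regs s'' 1 + 1)))) ->
  I 0%N s -> halts_in (for_cmd c) s (b * n) (I n).
Proof.
move=> Ireg Istep I0.
(* Induction on the number [k] of iterations still to be made. *)
suff loop k : (k <= n)%N -> forall s', I (n - k)%N s' ->
    halts_in (for_cmd c) s' (b * k) (I n).
  by apply: loop; rewrite ?subnn.
elim: k => [|k IH] kn s'.
  rewrite subn0 muln0 => In; exists s', 0%N; split=> //.
  by apply: run_while_stop => /=; have [-> ->] := Ireg _ _ In; rewrite ltnn.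
move=> Ik; have [r0 r1] := Ireg _ _ Ik.
have lt_n : (n - k.+1 < n)%N by rewrite ltn_subrL (leq_trans _ kn).
have [s1 [t1 [run1 t1b]]] := Istep _ _ lt_n Ik.
rewrite subnSK// => /(IH (ltnW kn))[s2 [t2 [run2 t2b In]]].
exists s2, (t1 + 0 + t2)%N; split=> //; last by rewrite addn0 mulnS leq_add.
rewrite -[(t1 + 0)%N]add0n; apply: run_while_step run2; first by rewrite /= r0 r1.
by apply: run_seq run1 _; exact: run_idx.
Qed.

(* Scratch memory: the cells n+1, n+2, n+3, which are 0 initially. *)
Let base := ICst 0.
Let entry := IAdd (IReg 1) (ICst 1).
Let acc := IAdd (IReg 0) (ICst 1).
Let tmp := IAdd (IReg 0) (ICst 2).
Let aux := IAdd (IReg 0) (ICst 3).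

(** * The projection program and its correctness *)

Definition norm_cmd :=
  CSeq (for_cmd (CSeq (CArith Mul tmp entry entry) (CArith Add acc acc tmp)))
       (CRoot 2 acc acc).

(** Follows [soc_factors]: [base] receives the first component and [tmp] the multiplier. The cell
    [aux] first serves as the constant 0 and is then loaded with 2. *)
Definition factors_cmd :=
  CIf (GReal Le acc base) (CCst tmp 1)
    (CSeq (CArith Add tmp base acc)
       (CIf (GReal Le tmp aux) (CSeq (CCst base 0) (CCst tmp 0))
          (CSeq (CCst aux 2)
             (CSeq (CArith Div base tmp aux) (CArith Div tmp base acc))))).

(** The counter is reset because the norm loop leaves it at [n]. *)
Definition scale_cmd :=
  CSeq (CIdx 1 (ICst 0)) (for_cmd (CArith Mul entry tmp entry)).

(** For [n = 0] the general branch would project onto a half-line, whereas the cone is [{0}]; the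
    test is on a register, hence free. *)
Definition proj_cmd :=
  CIf (GIdx (IReg 0) (ICst 1)) (CCst base 0)
    (CSeq norm_cmd (CSeq factors_cmd scale_cmd)).

(** The counter and [acc] already start at 0. Each entry costs a product and a sum, and the root is
    taken once. Preservation of the other cells keeps [aux] at 0 for the next phase. *)
Lemma halts_in_norm n (U : nat -> R) s :
  regs s =1 (fun i => if i == 0%N then n else 0%N) -> mem s =1 U ->
  U n.+1 = 0 ->
  halts_in norm_cmd s (2 * n + 1) (fun s' =>
    [/\ regs s' 0%N = n,
        mem s' n.+1 = Num.sqrt (\sum_(k < n) U k.+1 ^+ 2) &
        forall j : nat, j != n.+1 -> j != n.+2 -> mem s' j = U j]).
Proof.
move=> sreg smem U0; apply: halts_in_seq (leqnn _) _.
pose I i s' := [/\ regs s' 0%N = n, regs s' 1%N = i,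
  mem s' n.+1 = \sum_(k < i) U k.+1 ^+ 2 &
  forall j : nat, j != n.+1 -> j != n.+2 -> mem s' j = U j].
have := @halts_in_for
  (CSeq (CArith Mul tmp entry entry) (CArith Add acc acc tmp)) n 2 I s.
case=> [i s' []//|i s' lt_in [r0 r1 m1 mE]||].
- apply: (@halts_in_seq _ _ _ 1 1) => //.
  apply: halts_in_arith => //; apply: halts_in_arith => //.
  rewrite /I/= /cell /= !r0 !r1 !addn1 !addn2 !eqxx.
  rewrite (_ : (n.+1 == n.+2) = false); last by apply/eqP; lia.
  rewrite (mE i.+1); [|by lia..].
  split=> //; first by rewrite m1 big_ord_recr/= expr2.
  by move=> j j1 j2; rewrite (negPf j1) (negPf j2); exact: mE.
- by split=> [|||j _ _]; rewrite ?sreg ?smem ?U0 ?big_ord0.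
move=> s' [t [rs' tb [r0 _ m1 mE]]]; exists s', t; split=> //.
apply: halts_in_sqrt => //; rewrite /cell/= r0 addn1 m1.
  by rewrite sumr_ge0// => k _; rewrite sqr_ge0.
split=> //=; first by rewrite eqxx.
by move=> j jn /(mE _ jn); rewrite (negPf jn).
Qed.

(** The longest branch makes two comparisons, one addition and two divisions. *)
Lemma halts_in_factors n (t r : R) s Q :
  (0 < n)%N -> 0 <= r ->
  regs s 0%N = n -> mem s 0%N = t -> mem s n.+1 = r -> mem s n.+3 = 0 ->
  (forall s', regs s' 0%N = n -> mem s' 0%N = (soc_factors t r).1 ->
     mem s' n.+2 = (soc_factors t r).2 ->
     (forall j, (0 < j <= n)%N -> mem s' j = mem s j) -> Q s') ->
  halts_in factors_cmd s 5 Q.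
Proof.
move=> n0 r0 rn m0 m1 m3; rewrite /soc_factors => QP.
apply: (@halts_in_if _ _ _ _ 4); rewrite /= /cell /= rn addn1 m0 m1.
case: ifP QP => [_|/negbT]; last rewrite -ltNge.
  move=> QP; apply: halts_in_cst; apply: QP => //=; rewrite rn addn2 ?eqxx//=.
    by rewrite rmorph1.
  by move=> j jn; case: eqP => // jE; lia.
move=> tr QP; apply: (@halts_in_seq _ _ _ 1 3) => //.
apply: halts_in_arith => //.
apply: (@halts_in_if _ _ _ _ 2); rewrite /= /cell /= rn !addn1 !addn2 !addn3.
rewrite !eqxx m0 m1 m3.
rewrite (_ : (n.+3 == n.+2) = false); last by apply/eqP; lia.
case: ifP QP => [_ QP|/negbT]; last rewrite -ltNge.
  apply: (@halts_in_seq _ _ _ 1 1) => //.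
  apply: halts_in_cst; apply: halts_in_cst; apply: QP => //=.
  - by rewrite rn addn2/= rmorph0.
  - by rewrite rn addn2 eqxx rmorph0.
  by move=> j jn; rewrite rn addn2; do ![case: eqP => [?|_]; first lia].
move=> tr0 QP.
apply: (@halts_in_seq _ _ _ 0 2) => //.
apply: halts_in_cst; apply: (@halts_in_seq _ _ _ 1 1) => //.
have q2 : ratr 2 = 2 :> R by rewrite ratr_nat.
apply: halts_in_arith => //.
  by rewrite /cell/= rn eqxx q2.
have r_neq0 : r != 0 by rewrite gt_eqF//; lra.
have n12 : (n.+1 == n.+2) = false by apply/eqP; lia.
have n13 : (n.+1 == n.+3) = false by apply/eqP; lia.
have n23 : (n.+2 == n.+3) = false by apply/eqP; lia.
apply: halts_in_arith => //.
  by rewrite /cell/= rn addn1 addn2 addn3/= n12 n13 m1.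
apply: QP => //=; rewrite /cell /= rn !addn1 !addn2 !addn3 /= ?eqxx ?n12 ?n13 ?n23.
- by rewrite q2.
- by rewrite q2 m1.
by move=> j jn; do ![case: eqP => [?|_]; first lia].
Qed.

Lemma halts_in_scale n (f : R) s :
  regs s 0%N = n -> mem s n.+2 = f ->
  halts_in scale_cmd s n (fun s' => mem s' 0%N = mem s 0%N /\
    forall j, (0 < j <= n)%N -> mem s' j = f * mem s j).
Proof.
move=> rn mf; apply: (@halts_in_seq _ _ _ 0 n) => //; apply: halts_in_idx.
(* Cells 1 to [i] are already rescaled and later ones are untouched; cell 0 is excluded since it
   holds the finished first coordinate. *)
pose I i s' := [/\ regs s' 0%N = n, regs s' 1%N = i, mem s' n.+2 = f &
  forall j : nat, (j <= n)%N ->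
    mem s' j = if (0 < j <= i)%N then f * mem s j else mem s j].
have := @halts_in_for (CArith Mul entry tmp entry) n 1 I.
rewrite mul1n => /(_ (set_reg s 1 0)) H.
apply: (@halts_in_weaken _ _ n n (I n)) => //; last apply: H.
- move=> s' [_ _ _ mE]; split=> [|j jn]; rewrite mE ?jn//.
  by case/andP: jn.
- by move=> i s' [].
- move=> i s' lt_in [r0 r1 m2 mE].
  apply: halts_in_arith => //.
  rewrite /I/= /cell /= !r0 !r1 !addn1 !addn2.
  rewrite (_ : (n.+2 == i.+1) = false); last by apply/eqP; lia.
  split=> // j jn; case: eqP => [->|/eqP ji].
    by rewrite m2 mE// ltnn/= ltnSn.
  by rewrite mE// (_ : (j <= i.+1)%N = (j <= i)%N); last lia.
split=> // j jn.
by rewrite /=; case: ifP => //; lia.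
Qed.

(** The budget is [2 * n + 1] for the norm, 5 for the factors and [n] for the rescaling. *)
Lemma halts_in_proj n (u : 'rV[R]_(1 + n)) :
  halts_in proj_cmd (init_store u) (3 * n + 6) (fun s' =>
    is_proj (cone_over (n != 0)%:R (@unit_ball R n)) u (output n s')).
Proof.
apply: (@halts_in_if _ _ _ _ (3 * n + 6)) => /=.
case: posnP => n0.
  subst n; apply: halts_in_cst => /=.
  have -> : output 0 (set_cell (init_store u) base (ratr 0)) = 0.
    by apply/rowP => j; rewrite !mxE ord1/= rmorph0.
  have d0 (x : 'rV[R]_1) : dot x 0 = 0 by rewrite -(scale0r 0) dotZr mul0r.
  (* With [kappa = 0] and an empty tail, every generator of the cone is zero. *)
  have K0 (x : 'rV[R]_0) : row_mx 0%:M x = 0 by rewrite thinmx0 raddf0 row_mx0.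
  apply: is_proj_cone => //; last first.
    by move=> w [a [x [_ _ ->]]]; rewrite K0 scaler0 d0.
  by exists 0, 0; split; rewrite /unit_ball/= ?norm20 ?scale0r.
rewrite ltnNge n0/=.
have U0 k : (n < k)%N -> mem (init_store u) k = 0.
  by move=> nk; rewrite /= insubF// add1n ltnS leqNgt nk.
have UE (i : 'I_(1 + n)) : mem (init_store u) i = u 0 i.
  by rewrite /= insubT //= => lt_i; congr (u 0 _); exact: val_inj.
have uE : u = row_mx (u 0 0)%:M (rsubmx u).
  by rewrite -{1}(hsubmxK u) [lsubmx u]mx11_scalar mxE lshift0.
have normE : norm2 (rsubmx u) =
    Num.sqrt (\sum_(k < n) mem (init_store u) k.+1 ^+ 2).
  congr Num.sqrt; apply: eq_bigr => k _.
  by rewrite mxE -UE.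
apply: (@halts_in_seq _ _ _ (2 * n + 1) (n + 5)); first lia.
apply: halts_in_weaken (halts_in_norm (U := mem (init_store u)) _ _ _) => //;
  last exact: U0.
move=> s1 [rn m1 mE]; rewrite -normE in m1.
apply: (@halts_in_seq _ _ _ 5 n); first lia.
apply: (@halts_in_factors n (u 0 0) (norm2 (rsubmx u))) => //.
- exact: norm2_ge0.
- by rewrite mE// -UE.
- by rewrite mE ?U0//; lia.
move=> s2 r2 m20 m2f m2E.
apply: halts_in_weaken (halts_in_scale r2 m2f) => //.
move=> s3 [m30 m3E].
rewrite [X in is_proj _ X]uE.
have -> : output n s3 = row_mx (soc_factors (u 0 0) (norm2 (rsubmx u))).1%:M
    ((soc_factors (u 0 0) (norm2 (rsubmx u))).2 *: rsubmx u).
  apply/rowP => j; rewrite mxE; case: (split_ordP j) => k ->.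
    by rewrite row_mxEl ord1 mxE eqxx mulr1n -m20 -m30.
  have kn := ltn_ord k.
  (* Entry [k] of the tail lives in cell [k.+1], because cell 0 holds the first coordinate. *)
  rewrite row_mxEr !mxE -(UE (rshift 1 k)) -[nat_of_ord (rshift 1 k)]/k.+1.
  by rewrite m3E// m2E// mE//; lia.
exact: is_proj_soc.
Qed.

End Programs.

Theorem proposition4p5 (R : realType) (kappa : nat -> R)
    (hkappa : forall n : nat, is_max (@norm2 R n @` @unit_ball R n) (kappa n)) :
  exists (p : cmd) (T : nat -> nat),
    ((fun n : nat => (T n)%:R : R^o) =O_\oo (fun n : nat => n%:R : R^o)) /\
    computes_in p T
      (fun (n : nat) (u v : 'rV[R]_(1 + n)) =>
         is_proj (cone_over (kappa n) (@unit_ball R n)) u v).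
Proof.
exists proj_cmd, (fun n => 3 * n + 6)%N; split; first exact: affine_bigO.
move=> n u; rewrite (is_max_norm2_unit_ball (hkappa n)).
exact: halts_in_proj.
Qed.
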